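(* Let $\gamma_j\colon[0,+\infty)\to\mathbb{H}$, $j=1,2$, be two curves landing at $\infty$, with $$\lim_{t\to+\infty}\arg(\gamma_j(t))=\theta_j,$$ for some $\theta_j\in(-\tfrac{\pi}{2},\tfrac{\pi}{2})$, $j=1,2$. Suppose that $\{z_n\}\subset\mathbb{H}$ is a sequence converging to $\infty$ and let $\pi_{\gamma_j}(z_n)$ be a projection of $z_n$ onto $\gamma_j$, for $j=1,2$ and $n\in\mathbb{N}$. Then $$\lim_{n\to+\infty}d_{\mathbb{H}}(\pi_{\gamma_1}(z_n),\pi_{\gamma_2}(z_n))=d_{\mathbb{H}}(e^{i\theta_1},e^{i\theta_2}).$$
   Context: $\mathbb{H}=\{w\in\mathbb{C}:\mathrm{Re}\,w>0\}$ is the right half-plane, with hyperbolic metric $$d_{\mathbb{H}}(z,w)=\frac12\log\frac{1+\left|\frac{z-w}{z+\overline{w}}\right|}{1-\left|\frac{z-w}{z+\overline{w}}\right|},\qquad z,w\in\mathbb{H}.$$ A curve is a continuous map $\gamma\colon[0,+\infty)\to\mathbb{H}$; it lands at $\infty$ if $\gamma(t)\to\infty$ (i.e. $|\gamma(t)|\to+\infty$) as $t\to+\infty$. A sequence in $\mathbb{H}$ converges to $\infty$ if its modulus tends to $+\infty$. Given $z_0\in\mathbb{H}$, a point $\pi_\gamma(z_0)$ is a projection of $z_0$ onto $\gamma$ if $\pi_\gamma(z_0)=\gamma(t_0)$ for some $t_0\ge0$ and $d_{\mathbb{H}}(z_0,\gamma(t_0))=\inf\{d_{\mathbb{H}}(z_0,\gamma(t)):t\in[0,+\infty)\}$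 (projections exist but need not be unique). $\arg$ is the principal argument, with values in $(-\tfrac{\pi}{2},\tfrac{\pi}{2})$ on $\mathbb{H}$. *)

(* Defs.v *)
From Stdlib Require Import Reals Lra.
From Coquelicot Require Import Coquelicot.

Local Open Scope R_scope.

Definition Cexpi (t : R) : C := (cos t, sin t).

(* Principal argument with values in (-PI, PI], see [Carg_spec] and
   [Carg_unique]; junk value at 0. *)
Definition Carg (z : C) : R :=
  if Rle_dec 0 (Im z) then acos (Re z / Cmod z) else - acos (Re z / Cmod z).

Lemma Cmod_sqr (z : C) : Cmod z * Cmod z = Re z * Re z + Im z * Im z.
Proof.
unfold Cmod; rewrite sqrt_sqrt; [unfold Re, Im; ring | nra].
Qed.

Lemma Re_div_Cmod_bound (z : C) : z <> 0%C -> -1 <= Re z / Cmod z <= 1.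
Proof.
intros Hz; apply Cmod_gt_0 in Hz.
assert (H := Cmod_sqr z).
split.
- apply (Rmult_le_reg_r (Cmod z)); [lra|].
  replace (Re z / Cmod z * Cmod z) with (Re z) by (field; lra); nra.
- apply (Rmult_le_reg_r (Cmod z)); [lra|].
  replace (Re z / Cmod z * Cmod z) with (Re z) by (field; lra); nra.
Qed.

Lemma Carg_spec (z : C) : z <> 0%C ->
  -PI < Carg z <= PI /\ z = (RtoC (Cmod z) * Cexpi (Carg z))%C.
Proof.
intros Hz; assert (Hb := Re_div_Cmod_bound z Hz).
assert (Hm := proj1 (Cmod_gt_0 z) Hz); assert (H := Cmod_sqr z).
assert (Hc : Cmod z * cos (acos (Re z / Cmod z)) = Re z)
  by (rewrite cos_acos by exact Hb; field; lra).
assert (Hs : Cmod z * sin (acos (Re z / Cmod z)) = Rabs (Im z)).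
{ rewrite sin_acos by exact Hb.
  replace (1 - (Re z / Cmod z)²) with ((Im z / Cmod z)²).
  - rewrite sqrt_Rsqr_abs, Rabs_div, (Rabs_pos_eq (Cmod z)) by lra; field; lra.
  - unfold Rsqr; apply (Rmult_eq_reg_r (Cmod z * Cmod z)); [|nra].
    replace (Im z / Cmod z * (Im z / Cmod z) * (Cmod z * Cmod z))
      with (Im z * Im z) by (field; lra).
    replace ((1 - Re z / Cmod z * (Re z / Cmod z)) * (Cmod z * Cmod z))
      with (Cmod z * Cmod z - Re z * Re z) by (field; lra); lra. }
assert (Hr := acos_bound (Re z / Cmod z)); assert (HP := PI_RGT_0).
unfold Carg; destruct (Rle_dec 0 (Im z)) as [Hi|Hi].
- rewrite Rabs_pos_eq in Hs by exact Hi.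
  split; [lra|].
  rewrite (surjective_pairing z) at 1; unfold Cmult, Cexpi, RtoC; simpl.
  unfold Re, Im in *; f_equal; lra.
- rewrite Rabs_left in Hs by lra.
  split.
  + split; [|lra].
    destruct (Req_dec (acos (Re z / Cmod z)) PI) as [E|E]; [|lra].
    rewrite E, sin_PI in Hs; lra.
  + rewrite (surjective_pairing z) at 1; unfold Cmult, Cexpi, RtoC; simpl.
    rewrite cos_neg, sin_neg.
    unfold Re, Im in *; f_equal; lra.
Qed.

Lemma Carg_unique (z : C) (t : R) : z <> 0%C -> -PI < t <= PI ->
  z = (RtoC (Cmod z) * Cexpi t)%C -> Carg z = t.
Proof.
intros Hz Ht E; assert (Hm := proj1 (Cmod_gt_0 z) Hz).
assert (Er : Re z = Cmod z * cos t)
  by (rewrite E at 1; unfold Re, Cmult, Cexpi, RtoC; simpl; ring).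
assert (Ei : Im z = Cmod z * sin t)
  by (rewrite E at 1; unfold Im, Cmult, Cexpi, RtoC; simpl; ring).
assert (Ec : Re z / Cmod z = cos t) by (rewrite Er; field; lra).
unfold Carg; rewrite Ec; destruct (Rle_dec 0 (Im z)) as [Hi|Hi].
- destruct (Rle_dec 0 t) as [H0|H0]; [apply acos_cos; lra|].
  assert (0 < sin (- t)) by (apply sin_gt_0; lra).
  rewrite sin_neg in *; nra.
- destruct (Rle_dec 0 t) as [H0|H0].
  + assert (0 <= sin t) by (apply sin_ge_0; lra); nra.
  + rewrite <- cos_neg, acos_cos; lra.
Qed.

Definition HH (w : C) : Prop := 0 < Re w.

Definition dH (z w : C) : R :=
  1 / 2 * ln ((1 + Cmod ((z - w) / (z + Cconj w))%C) /
              (1 - Cmod ((z - w) / (z + Cconj w))%C)).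

(* Curves [0,+oo) -> HH are encoded by total functions on R whose values at
   negative times are irrelevant. *)
Definition is_curve (gamma : R -> C) : Prop :=
  (forall t : R, 0 <= t -> HH (gamma t)) /\
  continuous_on (fun t : R => 0 <= t) gamma.

Definition lands_at_infty (gamma : R -> C) : Prop :=
  is_lim (fun t => Cmod (gamma t)) p_infty p_infty.

Definition seq_to_infty (z : nat -> C) : Prop :=
  is_lim_seq (fun n => Cmod (z n)) p_infty.

Definition is_projection (gamma : R -> C) (z0 p : C) : Prop :=
  exists t0 : R, 0 <= t0 /\ p = gamma t0 /\
    Finite (dH z0 (gamma t0)) =
      Glb_Rbar (fun r : R => exists t : R, 0 <= t /\ r = dH z0 (gamma t)).

(* Main.v *)
Require Import Defs.
From Stdlib Require Import Reals Lra IndefiniteDescription.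
From Coquelicot Require Import Coquelicot.

Local Open Scope R_scope.

(** In polar coordinates [z = r e^(i a)], [w = s e^(i b)] the metric reads
    [cosh (2 d(z, w)) = (cosh (ln (s / r)) - sin a sin b) / (cos a cos b)],
    so minimising [d(z, .)] along a curve means minimising
    [(cosh (ln (s / r)) - sin a sin b) / cos b], the factor [cos a] being
    common to all competitors.

    Fix one curve, of limit angle [theta], and let [p n] be a projection of
    [z n].  By the intermediate value theorem the curve contains, for large
    [n], a point [q n] with the same modulus as [z n].  Minimality of [p n]
    against [q n] gives, writing [a], [b] and [b'] for the arguments of
    [z n], [p n] and [q n],
    [cosh (ln (|p n| / |z n|)) <= sin a sin b + cos b (1 - sin a sin b') / cos b'].
    The right-hand side is bounded, because [b'] tends to [theta]; hence
    [|p n|] is comparable with [|z n|] and tends to infinity, hence the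
    parameter of [p n] on the curve does too, and [b] tends to [theta].  Now
    the right-hand side tends to [1], whatever the behaviour of [a], so that
    [|p n| / |z n|] tends to [1] ([projection_asymptotics]).

    For two curves it follows that [|p1 n| / |p2 n|] tends to [1] while the
    arguments tend to [theta1] and [theta2].  The formula above is continuous
    in the ratio of moduli and in the angles, and [arcosh] is continuous at
    every [x >= 1], so [d(p1 n, p2 n)] converges to the value at ratio [1],
    which is [d(e^(i theta1), e^(i theta2))]. *)

(** * The half-plane metric in terms of the hyperbolic cosine *)

Definition arcosh (x : R) : R := ln (x + sqrt (x * x - 1)).

Lemma arcosh_lt (x y : R) : 1 <= x -> x < y -> arcosh x < arcosh y.
Proof.
intros Hx Hxy; apply ln_increasing.
- assert (H := sqrt_pos (x * x - 1)); lra.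
- assert (sqrt (x * x - 1) <= sqrt (y * y - 1)) by (apply sqrt_le_1_alt; nra).
  lra.
Qed.

Lemma arcosh_continuous (x : R) : 1 <= x -> continuous arcosh x.
Proof.
intros Hx; unfold arcosh.
apply (continuous_comp (fun x => x + sqrt (x * x - 1)) ln).
- apply (@continuous_plus _ _ R_NormedModule (fun x => x) (fun x => sqrt (x * x - 1))).
  + apply continuous_id.
  + apply continuous_sqrt_comp.
    apply (@continuous_minus _ _ R_NormedModule (fun x => x * x) (fun _ => 1)).
    * apply (@continuous_mult _ R_AbsRing (fun x => x) (fun x => x)); apply continuous_id.
    * apply continuous_const.
- apply continuous_ln; assert (H := sqrt_pos (x * x - 1)); lra.
Qed.

(** The quantity [cosh (2 d(z, w))], as a rational function of coordinates. *)
Definition cosh_2dH (z w : C) : R :=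
  (Cmod z * Cmod z + Cmod w * Cmod w - 2 * (Im z * Im w)) / (2 * (Re z * Re w)).

Lemma cosh_2dH_ge_1 (z w : C) : HH z -> HH w -> 1 <= cosh_2dH z w.
Proof.
unfold HH, cosh_2dH; intros Hz Hw.
assert (Hp := Rmult_lt_0_compat _ _ Hz Hw).
rewrite 2!Cmod_sqr.
apply (Rmult_le_reg_r (2 * (Re z * Re w))); [lra|].
unfold Rdiv; rewrite Rmult_assoc, Rinv_l by lra.
assert (H1 := Rle_0_sqr (Re z - Re w)); assert (H2 := Rle_0_sqr (Im z - Im w)).
unfold Rsqr in *; lra.
Qed.

(** With [a = |z - w|] and [b = |z + conj w|] one has
    [b^2 - a^2 = 4 Re z Re w], so that [cosh_2dH z w] is
    [(b^2 + a^2) / (b^2 - a^2)]; then [sqrt (cosh_2dH z w ^ 2 - 1)] is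
    [2 a b / (b^2 - a^2)], and the two add up to [(b + a) / (b - a)]. *)
Lemma dH_arcosh (z w : C) : HH z -> HH w -> dH z w = 1 / 2 * arcosh (cosh_2dH z w).
Proof.
unfold HH, dH, arcosh; intros Hz Hw; f_equal; f_equal.
assert (Hp := Rmult_lt_0_compat _ _ Hz Hw).
assert (Hne : (z + Cconj w)%C <> 0%C).
{ intros E; apply (f_equal (@fst R R)) in E.
  unfold Re in *; simpl in E; lra. }
rewrite Cmod_div by exact Hne.
assert (Ha := Cmod_sqr (z - w)%C); assert (Hb := Cmod_sqr (z + Cconj w)%C).
assert (Ha0 := Cmod_ge_0 (z - w)%C); assert (Hb0 := proj1 (Cmod_gt_0 _) Hne).
set (a := Cmod (z - w)%C) in *; set (b := Cmod (z + Cconj w)%C) in *.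
assert (Ez := Cmod_sqr z); assert (Ew := Cmod_sqr w).
assert (Ed : b * b - a * a = 4 * (Re z * Re w))
  by (rewrite Ha, Hb; destruct z, w; unfold Re, Im; simpl; ring).
assert (Es : b * b + a * a =
             2 * (Cmod z * Cmod z + Cmod w * Cmod w - 2 * (Im z * Im w)))
  by (rewrite Ha, Hb, Ez, Ew; destruct z, w; unfold Re, Im; simpl; ring).
assert (Hab : a < b) by nra.
assert (Hd : b * b - a * a <> 0) by lra.
assert (Hba : b - a <> 0) by lra.
assert (Ec : cosh_2dH z w = (b * b + a * a) / (b * b - a * a)).
{ unfold cosh_2dH; rewrite Ed, Es; field; unfold Re in *; lra. }
assert (Eq : sqrt (cosh_2dH z w * cosh_2dH z w - 1)
             = 2 * (a * b) / (b * b - a * a)).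
{ replace (cosh_2dH z w * cosh_2dH z w - 1)
    with (Rsqr (2 * (a * b) / (b * b - a * a)))
    by (rewrite Ec; unfold Rsqr; field; exact Hd).
  apply sqrt_Rsqr.
  apply Rmult_le_pos; [nra | left; apply Rinv_0_lt_compat; lra]. }
rewrite Eq, Ec; field; repeat split; lra.
Qed.

Lemma dH_le_cosh_2dH (z w w' : C) : HH z -> HH w -> HH w' ->
  dH z w <= dH z w' -> cosh_2dH z w <= cosh_2dH z w'.
Proof.
intros Hz Hw Hw' Hle; rewrite 2!dH_arcosh in Hle by assumption.
destruct (Rle_lt_dec (cosh_2dH z w) (cosh_2dH z w')) as [H|H]; [exact H|].
apply arcosh_lt in H; [lra | now apply cosh_2dH_ge_1].
Qed.

(** * Polar form *)

Definition ucos (z : C) : R := Re z / Cmod z.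
Definition usin (z : C) : R := Im z / Cmod z.

(** This is [cosh (ln r)] for [r > 0]. *)
Definition cosh_ln (r : R) : R := (r + / r) / 2.

Lemma HH_neq_0 (z : C) : HH z -> z <> 0%C.
Proof. intros Hz E; rewrite E in Hz; unfold HH, Re in Hz; simpl in Hz; lra. Qed.

Lemma HH_Cmod_gt_0 (z : C) : HH z -> 0 < Cmod z.
Proof. intros Hz; apply Cmod_gt_0, HH_neq_0, Hz. Qed.

Lemma ucos_gt_0 (z : C) : HH z -> 0 < ucos z.
Proof. intros Hz; apply Rdiv_lt_0_compat; [exact Hz | now apply HH_Cmod_gt_0]. Qed.

Lemma ucos2_usin2 (z : C) : HH z -> ucos z * ucos z + usin z * usin z = 1.
Proof.
intros Hz; apply HH_Cmod_gt_0 in Hz; assert (H := Cmod_sqr z); unfold ucos, usin.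
apply (Rmult_eq_reg_r (Cmod z * Cmod z)); [|nra].
replace ((Re z / Cmod z * (Re z / Cmod z) + Im z / Cmod z * (Im z / Cmod z))
         * (Cmod z * Cmod z)) with (Re z * Re z + Im z * Im z) by (field; lra).
lra.
Qed.

Lemma ucos_Carg (z : C) : HH z -> ucos z = cos (Carg z).
Proof.
intros Hz; destruct (Carg_spec z (HH_neq_0 z Hz)) as [_ E].
assert (Hm := HH_Cmod_gt_0 z Hz); unfold ucos.
apply (f_equal Re) in E; unfold Re, Cmult, Cexpi, RtoC in *; simpl in E.
rewrite E; field; lra.
Qed.

Lemma usin_Carg (z : C) : HH z -> usin z = sin (Carg z).
Proof.
intros Hz; destruct (Carg_spec z (HH_neq_0 z Hz)) as [_ E].
assert (Hm := HH_Cmod_gt_0 z Hz); unfold usin.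
apply (f_equal Im) in E; unfold Im, Cmult, Cexpi, RtoC in *; simpl in E.
rewrite E; field; lra.
Qed.

Lemma cosh_2dH_polar (z w : C) : HH z -> HH w ->
  cosh_2dH z w =
    (cosh_ln (Cmod w / Cmod z) - usin z * usin w) / (ucos z * ucos w).
Proof.
intros Hz Hw; assert (Hmz := HH_Cmod_gt_0 z Hz); assert (Hmw := HH_Cmod_gt_0 w Hw).
unfold HH in *; unfold cosh_2dH, cosh_ln, usin, ucos; field; repeat split; lra.
Qed.

Lemma cosh_ln_ge_1 (r : R) : 0 < r -> 1 <= cosh_ln r.
Proof.
intros Hr.
assert (E : cosh_ln r - 1 = Rsqr (r - 1) * / (2 * r))
  by (unfold cosh_ln, Rsqr; field; lra).
assert (0 <= Rsqr (r - 1) * / (2 * r))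
  by (apply Rmult_le_pos;
      [apply Rle_0_sqr | left; apply Rinv_0_lt_compat; lra]).
lra.
Qed.

(** The inverse of [cosh (ln r)] is two-valued, but its two branches merge at
    [1]: this follows from [(r - 1)^2 = 2 r (cosh_ln r - 1)] and
    [r <= 2 cosh_ln r]. *)
Lemma cosh_ln_lim_1 (r : nat -> R) : (forall n, 0 < r n) ->
  is_lim_seq (fun n => cosh_ln (r n)) 1 -> is_lim_seq r 1.
Proof.
intros Hr Hlim.
set (e := fun n => sqrt (4 * cosh_ln (r n) * (cosh_ln (r n) - 1))).
assert (He : is_lim_seq e 0).
{ replace 0 with (sqrt (4 * 1 * (1 - 1))) by
    (replace (4 * 1 * (1 - 1)) with 0 by ring; apply sqrt_0).
  apply is_lim_seq_continuous with (f := sqrt).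
  - apply continuity_pt_filterlim, continuous_sqrt.
  - apply is_lim_seq_mult'.
    + apply is_lim_seq_mult'; [apply is_lim_seq_const | exact Hlim].
    + apply is_lim_seq_minus'; [exact Hlim | apply is_lim_seq_const]. }
apply is_lim_seq_le_le with (u := fun n => 1 - e n) (w := fun n => 1 + e n).
- intros n.
  assert (Habs : Rabs (r n - 1) <= e n).
  { unfold e; rewrite <- sqrt_Rsqr_abs; apply sqrt_le_1_alt.
    assert (H1 := cosh_ln_ge_1 _ (Hr n)); specialize (Hr n).
    assert (Hi := Rinv_0_lt_compat _ Hr).
    assert (Eq : (r n - 1)² = 2 * r n * (cosh_ln (r n) - 1))
      by (unfold Rsqr, cosh_ln; field; lra).
    assert (r n <= 2 * cosh_ln (r n)) by (unfold cosh_ln; lra).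
    rewrite Eq; nra. }
  apply Rabs_le_between in Habs; lra.
- replace (Finite 1) with (Finite (1 - 0)) by (f_equal; ring).
  apply is_lim_seq_minus'; [apply is_lim_seq_const | exact He].
- replace (Finite 1) with (Finite (1 + 0)) by (f_equal; ring).
  apply is_lim_seq_plus'; [apply is_lim_seq_const | exact He].
Qed.

(** * Curves landing at infinity *)

(** Freezing the curve at its initial point for negative times makes its
    modulus continuous on the whole line, as the intermediate value and
    extreme value theorems require. *)
Lemma curve_Cmod_continuous (gamma : R -> C) (t : R) : is_curve gamma ->
  continuous (fun t => Cmod (gamma (Rmax 0 t))) t.
Proof.
intros [_ Hc].
assert (Hg : continuous (fun t => gamma (Rmax 0 t)) t).
{ apply filterlim_comp with
    (G := within (fun t => 0 <= t) (locally (Rmax 0 t))).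
  - intros P HP.
    assert (Hm : continuous (fun t => Rmax 0 t) t).
    { apply (continuous_ext (fun t => (t + Rabs t) * / 2)).
      - intros s; unfold Rmax; destruct (Rle_dec 0 s).
        + rewrite Rabs_pos_eq by lra; lra.
        + rewrite Rabs_left by lra; lra.
      - apply (@continuous_mult _ R_AbsRing (fun t => t + Rabs t) (fun _ => / 2)).
        + apply (@continuous_plus _ _ R_NormedModule (fun t => t) Rabs);
            [apply continuous_id | apply continuous_Rabs].
        + apply continuous_const. }
    apply Hm in HP; unfold filtermap in *.
    apply filter_imp with (2 := HP); intros s Hs; apply Hs, Rmax_l.
  - apply Hc, Rmax_l. }
unfold Cmod; apply continuous_sqrt_comp.
assert (Hf : continuous (fun t => fst (gamma (Rmax 0 t))) t).
{ apply continuous_comp with (f := fun t => gamma (Rmax 0 t)) (g := fst);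
    [exact Hg | destruct (gamma (Rmax 0 t)); apply continuous_fst]. }
assert (Hs : continuous (fun t => snd (gamma (Rmax 0 t))) t).
{ apply continuous_comp with (f := fun t => gamma (Rmax 0 t)) (g := snd);
    [exact Hg | destruct (gamma (Rmax 0 t)); apply continuous_snd]. }
apply (@continuous_plus _ _ R_NormedModule (fun t => fst (gamma (Rmax 0 t)) ^ 2)
                       (fun t => snd (gamma (Rmax 0 t)) ^ 2)).
- apply (continuous_ext (fun t => fst (gamma (Rmax 0 t)) * fst (gamma (Rmax 0 t))));
    [intros s; simpl; ring | now apply (@continuous_mult _ R_AbsRing)].
- apply (continuous_ext (fun t => snd (gamma (Rmax 0 t)) * snd (gamma (Rmax 0 t))));
    [intros s; simpl; ring | now apply (@continuous_mult _ R_AbsRing)].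
Qed.

(** A curve is bounded on compact time intervals, so it can only escape to
    infinity along times that do. *)
Lemma curve_escape_time (gamma : R -> C) (t : nat -> R) : is_curve gamma ->
  (forall n, 0 <= t n) -> is_lim_seq (fun n => Cmod (gamma (t n))) p_infty ->
  is_lim_seq t p_infty.
Proof.
intros Hc Ht Hlim; apply is_lim_seq_spec; intros T.
destruct (continuity_ab_maj (fun t => Cmod (gamma (Rmax 0 t))) 0 (Rmax 0 T))
  as [s [Hs _]].
- apply Rmax_l.
- intros c _; apply continuity_pt_filterlim.
  exact (curve_Cmod_continuous gamma c Hc).
- apply is_lim_seq_spec in Hlim.
  apply filter_imp with (2 := Hlim (Cmod (gamma (Rmax 0 s)))).
  intros n Hn; destruct (Rle_lt_dec (t n) T) as [Hle|Hlt]; [|exact Hlt].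
  assert (Hb : 0 <= t n <= Rmax 0 T)
    by (split; [apply Ht | apply Rle_trans with (1 := Hle), Rmax_r]).
  apply Hs in Hb; rewrite Rmax_right in Hb by apply Ht; lra.
Qed.

Lemma curve_same_modulus (gamma : R -> C) (m : R) : is_curve gamma ->
  lands_at_infty gamma -> Cmod (gamma 0) <= m ->
  exists t, 0 <= t /\ Cmod (gamma t) = m.
Proof.
intros Hc Hl Hm.
apply is_lim_spec in Hl; destruct (Hl m) as [T HT].
set (b := Rmax 0 (T + 1)).
assert (Hb : m < Cmod (gamma b)).
{ apply HT; apply Rlt_le_trans with (T + 1); [lra | apply Rmax_r]. }
assert (Hb0 : 0 <= b) by apply Rmax_l.
destruct (IVT_gen (fun t => Cmod (gamma (Rmax 0 t))) 0 b m) as [t [Ht E]].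
- intros c; apply continuity_pt_filterlim; exact (curve_Cmod_continuous gamma c Hc).
- rewrite (Rmax_right 0 0), (Rmax_right 0 b), Rmin_left, Rmax_right by lra; lra.
- rewrite Rmin_left, Rmax_right in Ht by lra.
  rewrite Rmax_right in E by lra.
  exists t; split; [lra | exact E].
Qed.

Definition tends_to_direction (q : nat -> C) (theta : R) : Prop :=
  is_lim_seq (fun n => ucos (q n)) (cos theta) /\
  is_lim_seq (fun n => usin (q n)) (sin theta).

Lemma curve_direction (gamma : R -> C) (theta : R) (t : nat -> R) :
  is_curve gamma -> is_lim (fun t => Carg (gamma t)) p_infty theta ->
  (forall n, 0 <= t n) -> is_lim_seq (fun n => Cmod (gamma (t n))) p_infty ->
  tends_to_direction (fun n => gamma (t n)) theta.
Proof.
intros Hc Ha Ht Hlim.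
assert (HT := curve_escape_time gamma t Hc Ht Hlim).
assert (HA : is_lim_seq (fun n => Carg (gamma (t n))) theta).
{ apply is_lim_comp_seq with (1 := Ha); [|exact HT].
  exists 0%nat; intros n _; discriminate. }
destruct Hc as [HG _]; split.
- apply is_lim_seq_ext with (fun n => cos (Carg (gamma (t n)))).
  + intros n; symmetry; apply ucos_Carg, HG, Ht.
  + apply is_lim_seq_continuous; [apply continuity_cos | exact HA].
- apply is_lim_seq_ext with (fun n => sin (Carg (gamma (t n)))).
  + intros n; symmetry; apply usin_Carg, HG, Ht.
  + apply is_lim_seq_continuous; [apply continuity_sin | exact HA].
Qed.

(** * Asymptotics of projections *)

Lemma projection_minimal (gamma : R -> C) (z p : C) (t : R) :
  is_projection gamma z p -> 0 <= t -> dH z p <= dH z (gamma t).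
Proof.
intros [t0 [_ [-> Hglb]]] Ht.
destruct (Glb_Rbar_correct (fun r => exists t, 0 <= t /\ r = dH z (gamma t)))
  as [Hlb _].
rewrite <- Hglb in Hlb; exact (Hlb (dH z (gamma t)) (ex_intro _ t (conj Ht eq_refl))).
Qed.

(** The common factor [ucos z] of the two distances cancels, leaving a bound
    that depends on [z] only through the bounded quantity [usin z]. *)
Lemma cosh_ln_le_same_modulus (z p q : C) : HH z -> HH p -> HH q ->
  Cmod q = Cmod z -> cosh_2dH z p <= cosh_2dH z q ->
  cosh_ln (Cmod p / Cmod z)
    <= usin z * usin p + ucos p * (1 - usin z * usin q) / ucos q.
Proof.
intros Hz Hp Hq E; rewrite 2!cosh_2dH_polar by assumption.
assert (Hm := HH_Cmod_gt_0 z Hz).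
replace (cosh_ln (Cmod q / Cmod z)) with 1
  by (rewrite E; unfold cosh_ln; field; lra).
apply ucos_gt_0 in Hz; apply ucos_gt_0 in Hp; apply ucos_gt_0 in Hq.
set (k := cosh_ln (Cmod p / Cmod z)); intros Hle.
apply (Rmult_le_compat_r (ucos z * ucos p)) in Hle; [|nra].
replace ((k - usin z * usin p) / (ucos z * ucos p) * (ucos z * ucos p))
  with (k - usin z * usin p) in Hle by (field; lra).
replace ((1 - usin z * usin q) / (ucos z * ucos q) * (ucos z * ucos p))
  with (ucos p * (1 - usin z * usin q) / ucos q) in Hle by (field; lra).
lra.
Qed.

Lemma projection_asymptotics (gamma : R -> C) (theta : R) (z p : nat -> C) :
  is_curve gamma -> lands_at_infty gamma -> - (PI / 2) < theta < PI / 2 ->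
  is_lim (fun t => Carg (gamma t)) p_infty theta ->
  (forall n, HH (z n)) -> seq_to_infty z ->
  (forall n, is_projection gamma (z n) (p n)) ->
  tends_to_direction p theta /\ is_lim_seq (fun n => Cmod (p n) / Cmod (z n)) 1.
Proof.
intros Hc Hl Hth Ha Hz Hzi Hp.
assert (Hcos : 0 < cos theta) by (apply cos_gt_0; lra).
destruct (functional_choice
  (fun n t => 0 <= t /\ (Cmod (gamma 0) <= Cmod (z n) ->
                         Cmod (gamma t) = Cmod (z n)))) as [t Ht].
{ intros n; destruct (Rle_dec (Cmod (gamma 0)) (Cmod (z n))) as [H|H].
  - destruct (curve_same_modulus gamma _ Hc Hl H) as [t Ht]; exists t; tauto.
  - exists 0; split; [lra | contradiction]. }
destruct (functional_choice (fun n s => 0 <= s /\ p n = gamma s)) as [s Hs].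
{ intros n; destruct (Hp n) as [s [H1 [H2 _]]]; now exists s. }
assert (Hev : eventually (fun n => Cmod (gamma (t n)) = Cmod (z n))).
{ assert (H := proj2 (is_lim_seq_spec _ _) Hzi (Cmod (gamma 0))).
  apply filter_imp with (2 := H); intros n Hn; apply (Ht n); lra. }
assert (Hq : forall n, HH (gamma (t n))) by (intros n; apply Hc, Ht).
assert (HHp : forall n, HH (p n))
  by (intros n; rewrite (proj2 (Hs n)); apply Hc, Hs).
assert (Hr : forall n, 0 < Cmod (p n) / Cmod (z n))
  by (intros n; apply Rdiv_lt_0_compat; apply HH_Cmod_gt_0; auto).
destruct (curve_direction gamma theta t Hc Ha) as [Hqc Hqs];
  [intros n; apply Ht | | ].
{ apply is_lim_seq_ext_loc with (2 := Hzi).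
  apply filter_imp with (2 := Hev); intros n Hn; now symmetry. }
assert (Hkey : eventually (fun n => cosh_ln (Cmod (p n) / Cmod (z n)) <=
  usin (z n) * usin (p n)
  + ucos (p n) * (1 - usin (z n) * usin (gamma (t n))) / ucos (gamma (t n)))).
{ apply filter_imp with (2 := Hev); intros n Hn.
  apply cosh_ln_le_same_modulus; auto.
  apply dH_le_cosh_2dH; auto.
  apply (projection_minimal gamma); [apply Hp | apply Ht]. }
(* Once [ucos] exceeds [cos theta / 2] along the points of equal modulus,
   minimality bounds [cosh_ln] by [1 + 4 / cos theta], and [/ r] is at most
   twice [cosh_ln r]. *)
set (c := / (2 * (1 + 4 / cos theta))).
assert (H4 : 0 < 4 / cos theta) by (apply Rdiv_lt_0_compat; lra).
assert (Hc0 : 0 < c) by (apply Rinv_0_lt_compat; lra).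
assert (Hcp : eventually (fun n => c * Cmod (z n) <= Cmod (p n))).
{ assert (Hhalf : 0 < cos theta / 2) by lra.
  assert (H := proj2 (is_lim_seq_spec _ _) Hqc (mkposreal _ Hhalf)).
  generalize (filter_and _ _ Hkey H); apply filter_imp; clear Hkey H.
  intros n [Hle Hn]; simpl in Hn; apply Rabs_lt_between in Hn.
  assert (Hmz := HH_Cmod_gt_0 _ (Hz n)).
  assert (H1 := ucos2_usin2 _ (Hz n)); assert (H2 := ucos2_usin2 _ (HHp n)).
  assert (H3 := ucos2_usin2 _ (Hq n)).
  assert (C2 := ucos_gt_0 _ (HHp n)); assert (C3 := ucos_gt_0 _ (Hq n)).
  assert (B : 0 <= 1 - usin (z n) * usin (gamma (t n)) <= 2) by (split; nra).
  assert (Bc : ucos (p n) <= 1) by nra.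
  assert (Bs : usin (z n) * usin (p n) <= 1) by nra.
  assert (Bi : / ucos (gamma (t n)) <= / (cos theta / 2))
    by (apply Rinv_le_contravar; lra).
  replace (/ (cos theta / 2)) with (2 / cos theta) in Bi by (field; lra).
  assert (I3 := Rinv_0_lt_compat _ C3).
  assert (Bb : ucos (p n) * (1 - usin (z n) * usin (gamma (t n)))
               / ucos (gamma (t n)) <= 2 * (2 / cos theta)).
  { apply Rmult_le_compat; [nra | lra | nra | exact Bi]. }
  assert (Ei : / (Cmod (p n) / Cmod (z n)) <= / c).
  { unfold c; rewrite Rinv_inv.
    specialize (Hr n); unfold cosh_ln in Hle; lra. }
  apply Rinv_le_contravar in Ei; [|apply Rinv_0_lt_compat, Hr].
  rewrite 2!Rinv_inv in Ei.
  apply (Rmult_le_compat_r (Cmod (z n))) in Ei; [|lra].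
  replace (Cmod (p n) / Cmod (z n) * Cmod (z n)) with (Cmod (p n)) in Ei
    by (field; lra).
  exact Ei. }
assert (Hpi : is_lim_seq (fun n => Cmod (p n)) p_infty).
{ apply is_lim_seq_le_p_loc with (1 := Hcp).
  replace p_infty with (Rbar_mult c p_infty).
  - now apply is_lim_seq_scal_l.
  - apply is_Rbar_mult_unique; apply is_Rbar_mult_sym.
    now apply is_Rbar_mult_p_infty_pos. }
assert (Hdir : tends_to_direction p theta).
{ destruct (curve_direction gamma theta s Hc Ha) as [H1 H2].
  - intros n; apply Hs.
  - apply is_lim_seq_ext with (2 := Hpi); intros n; now rewrite (proj2 (Hs n)).
  - split.
    + apply is_lim_seq_ext with (2 := H1); intros n; now rewrite (proj2 (Hs n)).
    + apply is_lim_seq_ext with (2 := H2); intros n; now rewrite (proj2 (Hs n)). }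
split; [exact Hdir|]; destruct Hdir as [Hpc Hps].
(* [usin (z n)] need not converge; it is eliminated through [|usin| <= 1]. *)
apply cosh_ln_lim_1; [exact Hr|].
apply is_lim_seq_le_le_loc with (u := fun _ => 1)
  (w := fun n => Rabs (usin (p n) - ucos (p n) * usin (gamma (t n))
                                    / ucos (gamma (t n)))
                 + ucos (p n) / ucos (gamma (t n))).
- apply filter_imp with (2 := Hkey); intros n Hle.
  split; [now apply cosh_ln_ge_1|].
  apply Rle_trans with (1 := Hle).
  assert (C3 := ucos_gt_0 _ (Hq n)).
  assert (H1 := ucos2_usin2 _ (Hz n)).
  replace (usin (z n) * usin (p n) + ucos (p n) *
           (1 - usin (z n) * usin (gamma (t n))) / ucos (gamma (t n)))
    with (usin (z n) * (usin (p n) - ucos (p n) * usin (gamma (t n))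
                                     / ucos (gamma (t n)))
          + ucos (p n) / ucos (gamma (t n))) by (field; lra).
  apply Rplus_le_compat_r.
  apply Rle_trans with (1 := Rle_abs _); rewrite Rabs_mult.
  assert (Hu : Rabs (usin (z n)) <= 1) by (apply Rabs_le; nra).
  assert (H0 := Rabs_pos (usin (p n) - ucos (p n) * usin (gamma (t n))
                                       / ucos (gamma (t n)))).
  nra.
- apply is_lim_seq_const.
- replace 1 with (Rabs (sin theta - cos theta * sin theta / cos theta)
                  + cos theta / cos theta).
  2:{ replace (sin theta - cos theta * sin theta / cos theta) with 0
        by (field; lra).
      rewrite Rabs_R0; field; lra. }
  apply is_lim_seq_plus'.
  + apply (is_lim_seq_abs _ (Finite _)), is_lim_seq_minus'; [exact Hps|].
    apply is_lim_seq_div'; [now apply is_lim_seq_mult' | exact Hqc | lra].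
  + apply is_lim_seq_div'; [exact Hpc | exact Hqc | lra].
Qed.

(** * Convergence of the distance *)

Lemma dH_lim (p q : nat -> C) (theta1 theta2 : R) :
  (forall n, HH (p n)) -> (forall n, HH (q n)) ->
  0 < cos theta1 -> 0 < cos theta2 ->
  tends_to_direction p theta1 -> tends_to_direction q theta2 ->
  is_lim_seq (fun n => Cmod (q n) / Cmod (p n)) 1 ->
  is_lim_seq (fun n => dH (p n) (q n)) (dH (Cexpi theta1) (Cexpi theta2)).
Proof.
intros Hp Hq C1 C2 [Hpc Hps] [Hqc Hqs] Hr.
assert (Hm : forall theta, Cmod (Cexpi theta) = 1).
{ intros theta; unfold Cmod, Cexpi; simpl fst; simpl snd.
  replace (cos theta ^ 2 + sin theta ^ 2) with 1; [apply sqrt_1|].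
  assert (H := sin2_cos2 theta); unfold Rsqr in H; lra. }
assert (HH1 : HH (Cexpi theta1)) by exact C1.
assert (HH2 : HH (Cexpi theta2)) by exact C2.
apply is_lim_seq_ext with (fun n => 1 / 2 * arcosh (cosh_2dH (p n) (q n))).
{ intros n; symmetry; now apply dH_arcosh. }
rewrite dH_arcosh by assumption.
apply is_lim_seq_mult'; [apply is_lim_seq_const|].
apply is_lim_seq_continuous.
{ apply continuity_pt_filterlim; apply arcosh_continuous.
  now apply cosh_2dH_ge_1. }
rewrite cosh_2dH_polar by assumption.
unfold ucos, usin; rewrite 2!Hm, !Rdiv_1_r.
apply is_lim_seq_ext with (fun n => (cosh_ln (Cmod (q n) / Cmod (p n))
  - usin (p n) * usin (q n)) / (ucos (p n) * ucos (q n))).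
{ intros n; symmetry; now apply cosh_2dH_polar. }
apply is_lim_seq_div'.
- apply is_lim_seq_minus'; [|now apply is_lim_seq_mult'].
  apply is_lim_seq_div'; [|apply is_lim_seq_const|lra].
  apply is_lim_seq_plus'; [exact Hr|].
  apply (is_lim_seq_inv _ (Finite 1)); [exact Hr|].
  intros E; injection E; lra.
- now apply is_lim_seq_mult'.
- unfold Re, Cexpi; simpl; nra.
Qed.

Theorem corollary4p5
  (gamma1 gamma2 : R -> C) (theta1 theta2 : R)
  (Hcurve1 : is_curve gamma1) (Hcurve2 : is_curve gamma2)
  (Hland1 : lands_at_infty gamma1) (Hland2 : lands_at_infty gamma2)
  (Htheta1 : - (PI / 2) < theta1 < PI / 2)
  (Htheta2 : - (PI / 2) < theta2 < PI / 2)
  (Harg1 : is_lim (fun t => Carg (gamma1 t)) p_infty theta1)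
  (Harg2 : is_lim (fun t => Carg (gamma2 t)) p_infty theta2)
  (z : nat -> C) (Hz : forall n, HH (z n)) (Hzinf : seq_to_infty z)
  (p1 p2 : nat -> C)
  (Hp1 : forall n, is_projection gamma1 (z n) (p1 n))
  (Hp2 : forall n, is_projection gamma2 (z n) (p2 n)) :
  is_lim_seq (fun n => dH (p1 n) (p2 n)) (dH (Cexpi theta1) (Cexpi theta2)).
Proof.
destruct (projection_asymptotics gamma1 theta1 z p1) as [D1 R1]; auto.
destruct (projection_asymptotics gamma2 theta2 z p2) as [D2 R2]; auto.
assert (HH1 : forall n, HH (p1 n))
  by (intros n; destruct (Hp1 n) as [t [Ht [-> _]]]; now apply Hcurve1).
assert (HH2 : forall n, HH (p2 n))
  by (intros n; destruct (Hp2 n) as [t [Ht [-> _]]]; now apply Hcurve2).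
apply dH_lim; auto; try (apply cos_gt_0; lra).
apply is_lim_seq_ext with
  (fun n => (Cmod (p2 n) / Cmod (z n)) / (Cmod (p1 n) / Cmod (z n))).
- intros n; assert (H := HH_Cmod_gt_0 _ (Hz n)).
  assert (H' := HH_Cmod_gt_0 _ (HH1 n)); field; lra.
- replace 1 with (1 / 1) by field.
  apply is_lim_seq_div'; [exact R2 | exact R1 | lra].
Qed.
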